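(* Let $D$ be a Prüfer domain and let $X\subseteq\mathrm{Max}(D)$ be a discrete splitting set of $D$. If $\mathrm{Crit}_X(D)=\emptyset$, then there is a group isomorphism $\mathrm{Inv}_X(D)\simeq\mathcal C_c(X,\mathbb Z)$.
   Context: $\mathrm{Inv}(D)$ is the group of invertible fractional ideals of $D$. For $X\subseteq\mathrm{Spec}(D)$, $X^\uparrow:=\{P\in\mathrm{Spec}(D)\mid Q\subseteq P\text{ for some }Q\in X\}$. The inverse topology on $\mathrm{Spec}(D)$ is the topology having as a subbasis of open sets the sets $\mathcal V(I)=\{P\in\mathrm{Spec}(D)\mid I\subseteq P\}$, for $I$ a finitely generated ideal. $X$ is a splitting set if $X=X^\uparrow$ and $X$ is open in the inverse topology (equivalently, $X=X^\uparrow$ and $\mathrm{Spec}(D)\setminus X$ is quasi-compact in the Zariski topology); it is discrete if $P\neq P^2$ for every $P\in X$. The support of a fractional ideal $I$ is $\mathrm{supp}(I):=\{P\in\mathrm{Spec}(D)\mid ID_P\neq D_P\}$, and $\mathrm{Inv}_X(D):=\{I\in\mathrm{Inv}(D)\mid\mathrm{supp}(I)\subseteq X\}$. A maximal ideal $M\in X$ is critical with respect to $X$ if there is no radical (integral) ideal $I\in\mathrm{Inv}_X(D)$ with $I\subseteq M$; $\mathrm{Crit}_X(D)$ is the set of such $M$. For a topological space $Y$, $\mathcal C_c(Y,\mathbb Z)$ is the group of continuous functions $f\colon Y\to\mathbb Z$ ($\mathbb Z$ discrete) with compact support, where the support is the closure of $f^{-1}(\mathbb Z\setminus\{0\})$.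 $X$ carries the (subspace) inverse topology. *)

(* Defs.v *)
From HB Require Import structures.
From mathcomp Require Import all_boot all_order all_algebra.
From mathcomp Require Import all_classical topology.

Set Implicit Arguments.
Unset Strict Implicit.
Unset Printing Implicit Defensive.

Import GRing.Theory.
Local Open Scope classical_set_scope.
Local Open Scope ring_scope.

Section SetProd.
Variable R : comNzRingType.
Implicit Types A B C : set R.

(* The additive subgroup generated by the products a * b when A or B is closed
   under opposite, as is the case everywhere below; it is used for products of
   (fractional) ideals, for extensions I D_P and for generated ideals. *)
Definition setprod A B : set R :=
  [set x | exists s : seq (R * R),
     (forall p, p \in s -> A p.1 /\ B p.2) /\ x = \sum_(p <- s) p.1 * p.2].

Lemma setprod_mul A B a b : A a -> B b -> setprod A B (a * b).
Proof.
move=> Aa Bb; exists [:: (a, b)]; split; last by rewrite big_seq1.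
by move=> p; rewrite inE => /eqP ->.
Qed.

Lemma setprod0 A B : setprod A B 0.
Proof. by exists [::]; rewrite big_nil; split. Qed.

Lemma setprodD A B u v : setprod A B u -> setprod A B v -> setprod A B (u + v).
Proof.
move=> [s [sP ->]] [t [tP ->]]; exists (s ++ t); rewrite big_cat; split=> // p.
by rewrite mem_cat => /orP[/sP|/tP].
Qed.

Lemma setprod_min A B C : C 0 -> (forall u v, C u -> C v -> C (u + v)) ->
  (forall a b, A a -> B b -> C (a * b)) -> setprod A B `<=` C.
Proof.
move=> C0 CD CM x [s [sP ->]]; rewrite big_seq; elim/big_ind: _ => //.
by move=> p /sP[]; exact: CM.
Qed.

Lemma setprodC A B : setprod A B = setprod B A.
Proof.
suff h A' B' : setprod A' B' `<=` setprod B' A' by apply/seteqP; split.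
apply: setprod_min; [exact: setprod0 | exact: setprodD |].
by move=> a b ? ?; rewrite mulrC; exact: setprod_mul.
Qed.

Lemma setprodA A B C : setprod A (setprod B C) = setprod (setprod A B) C.
Proof.
have h A' B' C' : setprod A' (setprod B' C') `<=` setprod (setprod A' B') C'.
  apply: setprod_min; [exact: setprod0 | exact: setprodD |] => a y Aa.
  move: y; apply: setprod_min; rewrite /= ?mulr0; first exact: setprod0.
    by move=> u v; rewrite mulrDr; exact: setprodD.
  by move=> b c ? ?; rewrite mulrA; do 2 apply: setprod_mul => //.
apply/seteqP; split; first exact: h.
by rewrite setprodC (setprodC A B) (setprodC A) (setprodC B C); exact: h.
Qed.

End SetProd.

Section Ideals.
Variable D : idomainType.
Implicit Types I J P : set D.

Definition ideal I :=
  I 0 /\ forall a u v, I u -> I v -> I (a * u + v).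

Definition fg_ideal I := exists s : seq D, I = setprod setT [set` s].

Definition radical_ideal I :=
  ideal I /\ forall x n, I (x ^+ n) -> I x.

Definition prime_ideal P :=
  [/\ ideal P, ~ P 1 & forall a b, P (a * b) -> P a \/ P b].

Lemma prime_idealE P :
  prime_ideal P <-> idealr_closed [in P] /\ prime_idealr_closed [in P].
Proof.
split=> [[[P0 PD] P1 PM]|[[P0 P1 PD] PM]].
  split; first split.
  - exact/mem_set.
  - by apply/negP => /set_mem.
  - by move=> a u v /set_mem ? /set_mem ?; exact/mem_set/PD.
  by move=> u v /set_mem/PM[?|?]; apply/orP; [left|right]; exact/mem_set.
split; first split.
- exact: set_mem.
- by move=> a u v /mem_set ? /mem_set ?; apply: set_mem; exact: PD.
- by move=> /mem_set; exact/negP.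
by move=> a b /mem_set/PM/orP[]/set_mem; [left|right].
Qed.

Record spec := Spec { spec_set :> set D; specP : prime_ideal spec_set }.

HB.instance Definition _ := gen_eqMixin spec.
HB.instance Definition _ := gen_choiceMixin spec.

Definition zero_locus I : set spec := [set P | I `<=` P].

(* [spec] carries the inverse topology, not the Zariski topology. *)
HB.instance Definition _ := isSubBaseTopological.Build spec fg_ideal zero_locus.

Definition maxSpec : set spec :=
  [set M | forall J, ideal J -> ~ J 1 -> M `<=` J -> J = M].

Definition upset (X : set spec) : set spec :=
  [set P | exists2 Q : spec, X Q & Q `<=` P].

Definition splitting_set (X : set spec) := X = upset X /\ open X.

Definition discrete_splitting_set (X : set spec) :=
  splitting_set X /\ forall P : spec, X P -> P <> setprod P P :> set D.

End Ideals.

Section FractionalIdeals.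
Variable D : idomainType.
Local Notation K := {fraction D}.
Local Notation "x %:F" := (@tofrac D x).
Implicit Types I J : set K.

Definition fracD : set K := range (@tofrac D).

Definition fractional_ideal I :=
  [/\ I 0,
      forall (a : D) u v, I u -> I v -> I (a%:F * u + v)
    & exists2 d : D, d != 0 & forall u, I u -> fracD (d%:F * u)].

Definition invertible I :=
  fractional_ideal I /\ exists2 J, fractional_ideal J & setprod I J = fracD.

Record InvD := MkInvD { InvD_set :> set K; InvDP : invertible InvD_set }.

HB.instance Definition _ := gen_eqMixin InvD.
HB.instance Definition _ := gen_choiceMixin InvD.

Lemma InvD_inj (I J : InvD) : I = J :> set K -> I = J.
Proof.
case: I J => [I Ip] [J Jp] /= IJ; rewrite IJ in Ip *.
by rewrite (Prop_irrelevance Ip Jp).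
Qed.

Lemma fractional_fracD : fractional_ideal fracD.
Proof.
split; first by exists 0; rewrite ?tofrac0.
  by move=> a _ _ [x _ <-] [y _ <-]; exists (a * x + y); rewrite // tofracD tofracM.
by exists 1; rewrite ?oner_neq0 // => u; rewrite tofrac1 mul1r.
Qed.

Lemma setprod_fracD I : I 0 ->
  (forall (a : D) u v, I u -> I v -> I (a%:F * u + v)) -> setprod fracD I = I.
Proof.
move=> I0 IL; apply/seteqP; split.
  apply: setprod_min => // [u v Iu Iv|_ b [a _ <-] Ib].
    by rewrite -(mul1r u) -tofrac1; exact: IL.
  by rewrite -[_ * b]addr0; exact: IL.
move=> x Ix; rewrite -(mul1r x); apply: setprod_mul => //.
by exists 1; rewrite ?tofrac1.
Qed.

Lemma fractional_setprod I J :
  fractional_ideal I -> fractional_ideal J -> fractional_ideal (setprod I J).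
Proof.
move=> [I0 IL [d d0 dI]] [J0 JL [e e0 eJ]]; split; first exact: setprod0.
  move=> a u v IJu IJv; apply: setprodD IJv.
  move: u IJu; apply: setprod_min; rewrite /= ?mulr0; first exact: setprod0.
    by move=> u w; rewrite mulrDr; exact: setprodD.
  move=> i j Ii Jj; rewrite mulrA -[_ * i]addr0.
  by apply: setprod_mul => //; exact: IL.
exists (d * e); first by rewrite mulf_neq0.
have [D0 DL _] := fractional_fracD.
apply: setprod_min => /=; rewrite ?mulr0 //.
  move=> u v du dv; rewrite mulrDr -[X in X + _]mul1r -tofrac1; exact: DL.
move=> i j /dI [x _ xi] /eJ [y _ yj]; exists (x * y) => //.
by rewrite !tofracM xi yj mulrACA.
Qed.

Lemma invertible_fracD : invertible fracD.
Proof.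
split; first exact: fractional_fracD.
exists fracD; first exact: fractional_fracD.
by apply: setprod_fracD; have [] := fractional_fracD.
Qed.

Lemma invertible_setprod I J :
  invertible I -> invertible J -> invertible (setprod I J).
Proof.
move=> [fI [I' fI' II']] [fJ [J' fJ' JJ']].
split; first exact: fractional_setprod.
exists (setprod J' I'); first exact: fractional_setprod.
rewrite -setprodA (setprodA J) JJ' setprod_fracD //; by case: fI'.
Qed.

Definition InvD_mul (I J : InvD) : InvD :=
  MkInvD (invertible_setprod (InvDP I) (InvDP J)).

Definition InvD_one : InvD := MkInvD invertible_fracD.

Lemma InvD_inv_ex (I : InvD) : exists J : InvD, setprod I J = fracD.
Proof.
case: I => I [fI [J fJ IJ]] /=.
have iJ : invertible J by split=> //; exists I => //; rewrite setprodC.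
by exists (MkInvD iJ).
Qed.

Definition InvD_inv (I : InvD) : InvD := projT1 (cid (InvD_inv_ex I)).

Lemma InvD_mulC : commutative InvD_mul.
Proof. by move=> I J; apply: InvD_inj; exact: setprodC. Qed.

Lemma InvD_mulA : associative InvD_mul.
Proof. by move=> I J L; apply: InvD_inj; exact: setprodA. Qed.

Lemma InvD_mul1 : left_id InvD_one InvD_mul.
Proof.
by move=> [I [fI iI]]; apply: InvD_inj => /=; apply: setprod_fracD; case: fI.
Qed.

Lemma InvD_mul1r : right_id InvD_one InvD_mul.
Proof. by move=> I; rewrite InvD_mulC InvD_mul1. Qed.

Lemma InvD_mulVr : right_inverse InvD_one InvD_inv InvD_mul.
Proof. by move=> I; apply: InvD_inj; exact: (projT2 (cid (InvD_inv_ex I))). Qed.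

Lemma InvD_mulV : left_inverse InvD_one InvD_inv InvD_mul.
Proof. by move=> I; rewrite InvD_mulC InvD_mulVr. Qed.

HB.instance Definition _ :=
  isGroup.Build InvD InvD_mulA InvD_mul1 InvD_mul1r InvD_mulV InvD_mulVr.

(* The localization D_P, as a subring of the fraction field. *)
Definition locD (P : spec D) : set K :=
  [set x | exists a s : D, ~ spec_set P s /\ x = a%:F / s%:F].

Definition supp I : set (spec D) := [set P | setprod I (locD P) <> locD P].

Lemma setprod_locD P : setprod fracD (locD P) = locD P.
Proof.
have [[P0 PL] P1 PM] := specP P; apply: setprod_fracD.
  by exists 0, 1; rewrite tofrac0 mul0r.
move=> a _ _ [x [s [Ps ->]]] [y [t [Pt ->]]].
exists (a * x * t + y * s), (s * t); split; first by move=> /PM[].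
have s0 : s%:F != 0 by rewrite tofrac_eq0; apply: contra_notN Ps => /eqP ->.
have t0 : t%:F != 0 by rewrite tofrac_eq0; apply: contra_notN Pt => /eqP ->.
by rewrite tofracD !tofracM mulrA (addf_div _ _ s0 t0).
Qed.

Variable X : set (spec D).

Definition InvX : {pred InvD} := [pred I : InvD | `[< supp I `<=` X >]].

Lemma in_InvX (I : InvD) : I \in InvX <-> supp I `<=` X.
Proof. by split=> [/asboolP|?] //; apply/asboolP. Qed.

Lemma InvX_closed : group_closed InvX.
Proof.
have suppN I P : supp I `<=` X -> ~ X P -> setprod I (locD P) = locD P.
  by move=> IX XP; apply: contrapT => /IX.
split=> [|I J].
  by apply/in_InvX => P; rewrite /supp /= setprod_locD.
move=> /in_InvX IX /in_InvX JX; apply/in_InvX => P sP; apply: contrapT => XP.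
apply: sP => /=; rewrite -setprodA.
have JV : setprod (InvD_inv J) (locD P) = locD P.
  rewrite -{1}(suppN _ _ JX XP) setprodA.
  by have /(congr1 InvD_set) /= -> := InvD_mulV J; exact: setprod_locD.
by rewrite JV; exact: suppN.
Qed.

Definition InvX_type := {I : InvD | I \in InvX}.

HB.instance Definition _ := SubChoice.on InvX_type.
HB.instance Definition _ :=
  SubChoice_isSubGroup.Build InvD InvX InvX_type InvX_closed.

(* An integral ideal is viewed both as the subset I of the fraction field and
   as its preimage in D. *)
Definition Crit : set (spec D) :=
  [set M | [/\ X M, maxSpec M &
     ~ exists I : InvD, [/\ I \in InvX, I `<=` fracD,
         radical_ideal (@tofrac D @^-1` I) & @tofrac D @^-1` I `<=` M]]].

End FractionalIdeals.

Definition prufer (D : idomainType) :=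
  forall I : set D, fg_ideal I -> I <> [set 0] -> invertible (@tofrac D @` I).

Section CompactSupport.
Variable Y : topologicalType.

Definition fsupport (f : Y -> int) : set Y := closure (f @^-1` [set~ 0]).

Definition Cc : {pred Y -> int} :=
  [pred f : Y -> int | `[< continuous (f : Y -> discrete_topology int)
                          /\ compact (fsupport f) >]].

Lemma in_Cc (f : Y -> int) : f \in Cc <->
  continuous (f : Y -> discrete_topology int) /\ compact (fsupport f).
Proof. by split=> [/asboolP|?] //; apply/asboolP. Qed.

Lemma Cc_closed : zmod_closed Cc.
Proof.
have contP (f : Y -> int) : continuous (f : Y -> discrete_topology int) <->
    forall y, nbhs y [set z | f z = f y].
  split=> cf y; first exact: (cf y [set f y] (discrete_set1 _)).
  move=> A /= fyA; apply: filterS (cf y) => z /= fz.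
  by rewrite /= fz; exact: (@nbhs_singleton (discrete_topology int) (f y)).
split=> [|f g].
  apply/in_Cc; split; first by apply/contP => y; exact: filterS filterT.
  have -> : fsupport 0 = set0.
    rewrite /fsupport (_ : _ @^-1` _ = set0) ?closure0 //.
    by apply/seteqP; split=> // y /(_ erefl).
  exact: compact0.
move=> /in_Cc[/contP cf kf] /in_Cc[/contP cg kg]; apply/in_Cc; split.
  apply/contP => y; apply: filterS2 (cf y) (cg y) => z /= fz gz.
  by rewrite !fctE fz gz.
apply: (@subclosed_compact _ _ (fsupport f `|` fsupport g)).
- exact: closed_closure.
- exact: compactU.
rewrite /fsupport -closureU; apply: closureS => y /= fgy.
have [fy|fy] := eqVneq (f y) 0; last by left; apply/eqP.
by right=> gy; apply: fgy; rewrite !fctE fy gy subr0.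
Qed.

HB.instance Definition _ := GRing.isZmodClosed.Build (Y -> int) Cc Cc_closed.

Definition Cc_type := {f : Y -> int | f \in Cc}.

HB.instance Definition _ := SubChoice.on Cc_type.
HB.instance Definition _ := [SubChoice_isSubZmodule of Cc_type by <:].

End CompactSupport.

(* Main.v *)
Require Import Defs.
From mathcomp Require Import all_boot all_order all_algebra.
From mathcomp Require Import finmap all_classical topology.

Set Implicit Arguments.
Unset Strict Implicit.
Unset Printing Implicit Defensive.

Import Order.TTheory GRing.Theory Num.Theory.
Local Open Scope classical_set_scope.
Local Open Scope ring_scope.

(** Every P in X is a maximal ideal different from its square, so the valuation
ring D_P has a principal maximal ideal, generated by some p in P
([uniformizer_ex]).  An ideal I of Inv_X(D) satisfies I D_P = p^n D_P for a
unique integer n, although D_P may have dimension greater than one: the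
intersection of the powers of P D_P contracts to a prime Q which is strictly
below P, hence outside of X, so that I D_Q = D_Q, and this prevents a generator
of I D_P, or its inverse, from being divisible by all the powers of p
([ord_ex]).  The isomorphism sends I to the function P |-> n, written [pval].

It is a morphism since orders add up.  It is injective because an ideal of
order 0 everywhere on X lies in D_M for all maximal M, and the intersection of
these rings is D; apply this to I and to its inverse ([pval0_eq1]).

The support of I is the set of primes containing the integral ideal of the t
with t I and t I^-1 integral ([supp_ideal]).  Any set of primes of this kind is
compact for the inverse topology, since an ultrafilter U converges to the prime
of the d that belong to U-almost all primes ([pval_compact]); it is moreover
closed among the maximal ideals, by comaximality.  Now emptiness of Crit_X(D)
puts every P of X above a radical ideal of Inv_X(D), whose order is 1 wherever
it is not 0.  Subtracting a multiple of the order function of that ideal reduces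
local constancy of [pval] near P to the case of order 0 at P, that is, to the
closedness of supports ([pval_continuous]).

For surjectivity, adding finitely many elements to such a radical ideal gives a
finitely generated ideal (s), invertible because D is a Pruefer domain, whose
order function is the indicator of the primes containing s
([tame_indicator]).  These sets form a basis of the topology of X, are stable
under intersection, and can be chosen so small that a given continuous f is
constant on each.  Finitely many of them cover the support of f, and
inclusion-exclusion writes f as an integral combination of their indicators
([Cc_realized]). *)

(** * Localizations at primes *)

Lemma divf_telescope (F : fieldType) (x y z w p : F) : x != 0 -> y != 0 ->
    z != 0 -> w != 0 ->
  z / x * (w / y) * ((x * y) / (z * w) / p) = p^-1.
Proof.
move=> x0 y0 z0 w0; rewrite mulf_div -[X in _ * (X / _)]invf_div mulVKf //.
by rewrite !mulf_neq0 ?invr_neq0 ?mulf_neq0.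
Qed.

(** Lets a prime or an invertible ideal, which coerce to sets, be applied to an
element. *)
#[local] Identity Coercion fun_of_set : set >-> Funclass.

Section Localization.
Variable D : idomainType.
Local Notation K := {fraction D}.
Local Notation "x %:F" := (@tofrac D x).
Implicit Types (P Q : spec D) (I J : InvD D).

Lemma tofrac_inj : injective (@tofrac D).
Proof. by move=> x y /eqP; rewrite tofrac_eq => /eqP. Qed.

Lemma spec0 P : P 0.
Proof. by have [[]] := specP P. Qed.

Lemma specDM P a u v : P u -> P v -> P (a * u + v).
Proof. by have [[_ h] _ _] := specP P; exact: h. Qed.

Lemma specMl P a u : P u -> P (a * u).
Proof. by move=> Pu; rewrite -[_ * _]addr0; apply: specDM => //; exact: spec0. Qed.

Lemma specMr P a u : P u -> P (u * a).
Proof. by rewrite mulrC; exact: specMl. Qed.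

Lemma specD P u v : P u -> P v -> P (u + v).
Proof. by move=> Pu Pv; rewrite -[u]mul1r; exact: specDM. Qed.

Lemma spec1 P : ~ P 1.
Proof. by have [] := specP P. Qed.

Lemma spec_prime P a b : P (a * b) -> P a \/ P b.
Proof. by have [_ _] := specP P; apply. Qed.

Lemma specNM P a b : ~ P a -> ~ P b -> ~ P (a * b).
Proof. by move=> ? ? /spec_prime[]. Qed.

Lemma spec_neq0 P s : ~ P s -> s != 0.
Proof. by apply: contra_notN => /eqP ->; exact: spec0. Qed.

Lemma spec_tofrac_neq0 P s : ~ P s -> s%:F != 0.
Proof. by rewrite tofrac_eq0; exact: spec_neq0. Qed.

Lemma locD_frac P a s : ~ P s -> locD P (a%:F / s%:F).
Proof. by exists a, s. Qed.

Lemma locD_tofrac P a : locD P a%:F.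
Proof. by exists a, 1; split; [exact: spec1|rewrite tofrac1 divr1]. Qed.

Lemma locD0 P : locD P 0.
Proof. by rewrite -tofrac0; exact: locD_tofrac. Qed.

Lemma locD1 P : locD P 1.
Proof. by rewrite -tofrac1; exact: locD_tofrac. Qed.

Lemma locDM P x y : locD P x -> locD P y -> locD P (x * y).
Proof.
move=> [a [s [Ps ->]]] [b [t [Pt ->]]]; exists (a * b), (s * t).
by split; [exact: specNM|rewrite !tofracM mulf_div].
Qed.

Lemma locDD P x y : locD P x -> locD P y -> locD P (x + y).
Proof.
move=> [a [s [Ps ->]]] [b [t [Pt ->]]]; exists (a * t + b * s), (s * t).
split; first exact: specNM.
by rewrite addf_div ?(spec_tofrac_neq0 (P := P)) // tofracD !tofracM.
Qed.

Lemma locDX P x n : locD P x -> locD P (x ^+ n).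
Proof.
move=> Lx; elim: n => [|n IHn]; first exact: locD1.
by rewrite exprS; exact: locDM.
Qed.

Lemma locDV P s : ~ P s -> locD P s%:F^-1.
Proof. by move=> Ps; exists 1, s; rewrite tofrac1 mul1r. Qed.

Lemma locD_unit P a : locD P a%:F^-1 -> a != 0 -> ~ P a.
Proof.
move=> [b [s [Ps ab]]] a0 Pa; apply: (Ps).
suff -> : s = a * b by exact: specMr.
have s0 := spec_tofrac_neq0 Ps.
apply: tofrac_inj; rewrite tofracM -[b%:F](divfK s0) -ab mulVKf //.
by rewrite tofrac_eq0.
Qed.

(** * Invertible ideals are locally principal *)

Lemma InvD0 I : I 0.
Proof. by have [[]] := InvDP I. Qed.

Lemma InvD_lin I (a : D) u v : I u -> I v -> I (a%:F * u + v).
Proof. by have [[_ h _] _] := InvDP I; exact: h. Qed.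

Lemma InvDM I (a : D) u : I u -> I (a%:F * u).
Proof. by move=> Iu; rewrite -[_ * _]addr0; apply: InvD_lin => //; exact: InvD0. Qed.

Lemma InvD_mulV_integral I x y : I x -> (I^-1)%g y -> exists d : D, x * y = d%:F.
Proof.
move=> Ix Jy; have : (I * I^-1)%g (x * y) by exact: setprod_mul.
by rewrite mulgV => -[d _ <-]; exists d.
Qed.

(** The relation that makes an invertible ideal finitely generated: the first
components of [s] generate I. *)
Lemma InvD_unity I : exists s : seq (K * K),
  (forall q, q \in s -> I q.1 /\ (I^-1)%g q.2) /\ 1 = \sum_(q <- s) q.1 * q.2.
Proof.
suff : (I * I^-1)%g 1 by [].
by rewrite mulgV; exists 1; rewrite ?tofrac1.
Qed.

Lemma spec_sum P (T : eqType) (s : seq T) (F : T -> D) :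
  ~ P (\sum_(q <- s) F q) -> exists2 q, q \in s & ~ P (F q).
Proof.
move=> h; apply: contrapT => nq; apply: h; rewrite big_seq.
apply: big_ind => [|u v|q qs]; [exact: spec0|exact: specD|].
by apply: contrapT => ?; apply: nq; exists q.
Qed.

(** One of the terms x * y of the relation of [InvD_unity], which are elements of D
with sum 1, lies outside of P. *)
Lemma InvD_local I P : exists x y s,
  [/\ I x, (I^-1)%g y, ~ P s & x * y = s%:F].
Proof.
have [s [sI s1]] := InvD_unity I.
have h (q : K * K) : exists d : D, q \in s -> q.1 * q.2 = d%:F.
  have [qs|qs] := boolP (q \in s); last by exists 0.
  by have [q1 q2] := sI _ qs; have [d dE] := InvD_mulV_integral q1 q2; exists d.
have [F FE] := choice h.
have : ~ P (\sum_(q <- s) F q).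
  suff -> : \sum_(q <- s) F q = 1 by exact: spec1.
  apply: tofrac_inj; rewrite raddf_sum tofrac1 s1 big_seq [RHS]big_seq.
  by apply: eq_bigr => q qs; exact: esym (FE q qs).
move=> /spec_sum[q qs Pq]; have [q1 q2] := sI _ qs.
by exists q.1, q.2, (F q); split => //; exact: FE.
Qed.

(** The term x * y = s of [InvD_local] makes x a generator of I D_P; the fourth
clause records that y = s / x is in the inverse of I. *)
Lemma InvD_local_gen I P : exists x s,
  [/\ I x, x != 0, ~ P s, (I^-1)%g (s%:F / x)
    & forall y, I y -> locD P (y / x)].
Proof.
have [x [z [s [Ix Jz Ps xz]]]] := InvD_local I P.
have s0 := spec_tofrac_neq0 Ps.
have x0 : x != 0 by apply: contraNneq s0 => x0; rewrite -xz x0 mul0r.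
exists x, s; split=> // [|y Iy]; first by rewrite -xz mulrC mulKf.
have [d dE] := InvD_mulV_integral Iy Jz.
suff -> : y / x = d%:F / s%:F by exact: locD_frac.
have z0 : z != 0 by apply: contraNneq s0 => z0; rewrite -xz z0 mulr0.
by rewrite -dE -xz -mulf_div divff ?mulr1.
Qed.

Lemma common_denom P (s : seq K) : (forall x, x \in s -> locD P x) ->
  exists2 t : D, ~ P t & forall x, x \in s -> exists d : D, t%:F * x = d%:F.
Proof.
elim: s => [|y s IHs] sP; first by exists 1; [exact: spec1|].
have [x xs|t Pt th] := IHs; first by apply: sP; rewrite inE xs orbT.
have [a [u [Pu yE]]] := sP y (mem_head _ _).
exists (t * u); first exact: specNM.
move=> x; rewrite inE => /predU1P[->|/th[d dE]].
  exists (t * a); rewrite yE !tofracM mulrACA divff ?mulr1 //.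
  exact: spec_tofrac_neq0 Pu.
by exists (u * d); rewrite !tofracM mulrAC dE mulrC.
Qed.

(** A common denominator of the finitely many generators of I serves for all of I. *)
Lemma InvD_locD_denom I P : I `<=` locD P ->
  exists2 t : D, ~ P t & forall x, I x -> exists d : D, t%:F * x = d%:F.
Proof.
move=> IP; have [s [sI s1]] := InvD_unity I.
have [x /mapP[q /sI[q1 _] ->]|t Pt th] := @common_denom P [seq q.1 | q <- s].
  exact: IP.
exists t => // x Ix.
suff : @fracD D (t%:F * x) by case=> d _ <-; exists d.
have [L0 LD _] := fractional_fracD D.
rewrite -[t%:F * x]mulr1 s1 mulr_sumr big_seq.
apply: big_ind => [//|u v Lu Lv|q qs].
  by rewrite -[u]mul1r -tofrac1; exact: LD.
have [q1 q2] := sI _ qs.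
have [d dE] := th _ (map_f _ qs); have [e eE] := InvD_mulV_integral Ix q2.
by exists (d * e) => //; rewrite tofracM -dE -eE mulrACA.
Qed.

Lemma InvV_sub I P : setprod I (locD P) = locD P -> (I^-1)%g `<=` locD P.
Proof.
move=> IP.
have : setprod (I^-1)%g (locD P) = locD P.
  rewrite -{1}IP setprodA.
  by have /(congr1 (@InvD_set D)) /= -> := mulVg I; exact: setprod_locD.
move=> <- x Ix; rewrite -[x]mulr1; apply: setprod_mul => //; exact: locD1.
Qed.

Lemma Inv_sub I P : setprod I (locD P) = locD P -> I `<=` locD P.
Proof.
by move=> <- x Ix; rewrite -[x]mulr1; apply: setprod_mul => //; exact: locD1.
Qed.

(** Its zero locus is the support of I. *)
Definition supp_ideal I : set D :=
  [set t | (forall x, I x -> exists d : D, t%:F * x = d%:F) /\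
           (forall x, (I^-1)%g x -> exists d : D, t%:F * x = d%:F)].

Lemma supp_ideal_inv I P : I `<=` locD P -> (I^-1)%g `<=` locD P ->
  exists2 t, ~ P t & supp_ideal I t.
Proof.
move=> /InvD_locD_denom[t Pt th] /InvD_locD_denom[u Pu uh].
exists (t * u); first exact: specNM.
split=> x.
  by move=> /th[d dE]; exists (u * d); rewrite !tofracM mulrAC dE mulrC.
by move=> /uh[d dE]; exists (t * d); rewrite !tofracM -mulrA dE.
Qed.

Lemma supp_ideal_supp I P : supp_ideal I `<=` P -> supp I P.
Proof.
move=> AP IP.
by have [t Pt /AP] := supp_ideal_inv (Inv_sub IP) (InvV_sub IP).
Qed.

Lemma supp_ideal_locD I P t : supp_ideal I t -> ~ P t ->
  I `<=` locD P /\ (I^-1)%g `<=` locD P.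
Proof.
move=> [tI tJ] Pt.
by split=> x => [/tI|/tJ] [d dE];
   rewrite -[x](mulKf (spec_tofrac_neq0 Pt)) dE mulrC; exact: locD_frac.
Qed.

Lemma supp_integral I P : I `<=` @fracD D -> supp I P <->
  @tofrac D @^-1` I `<=` P.
Proof.
move=> ID; split.
  move=> sI a Ia; apply: contrapT => Pa; apply: sI.
  apply/seteqP; split.
    apply: setprod_min => [|x y|_ b /ID[d _ <-] Lb].
    - exact: locD0.
    - exact: locDD.
    - by apply: locDM => //; exact: locD_tofrac.
  move=> x Lx; rewrite -[x](mulVKf (spec_tofrac_neq0 Pa)).
  by apply: setprod_mul => //; apply: locDM => //; exact: locDV.
move=> IP IL; have : setprod I (locD P) 1 by rewrite IL; exact: locD1.
suff : setprod I (locD P) `<=`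
    [set x | exists a s, [/\ P a, ~ P s & x = a%:F / s%:F]].
  move=> h /h[a [s [Pa Ps /esym]]]; have s0 := spec_tofrac_neq0 Ps.
  by move=> /(canRL (mulfVK s0)); rewrite mul1r => /tofrac_inj aE; rewrite aE in Pa.
apply: setprod_min => [|_ _ [a [s [Pa Ps ->]]] [b [t [Pb Pt ->]]]|_ _ /[dup]/ID[a _ <-] Ia [b [s [Ps ->]]]].
- by exists 0, 1; split; [exact: spec0|exact: spec1|rewrite tofrac0 mul0r].
- exists (a * t + b * s), (s * t); split; last first.
  + by rewrite addf_div ?(spec_tofrac_neq0 (P := P)) // tofracD !tofracM.
  + exact: specNM.
  by apply: specD; exact: specMr.
- exists (a * b), s; split => //; last by rewrite tofracM mulrA.
  by apply: specMr; exact: IP.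
Qed.

(** * Finitely generated ideals and valuations in Pruefer domains *)

Lemma ideal_adjoin (M : set D) s : ideal M ->
  ideal [set x | exists r t, M t /\ x = r * s + t].
Proof.
move=> [M0 MD]; split; first by exists 0, 0; rewrite mul0r addr0.
move=> a _ _ [r [t [Mt ->]]] [r' [t' [Mt' ->]]].
exists (a * r + r'), (a * t + t'); split; first exact: MD.
by rewrite mulrDr mulrDl -!mulrA addrACA.
Qed.

Section Pruefer.
Hypothesis prD : prufer D.

Definition genideal (s : seq D) : set D := setprod setT [set` s].

Lemma genideal_mem s x : x \in s -> genideal s x.
Proof. by move=> xs; rewrite -[x]mul1r; exact: setprod_mul. Qed.

Lemma genideal_min s (C : set D) : ideal C -> (forall x, x \in s -> C x) ->
  genideal s `<=` C.
Proof.
move=> [C0 CD] sC; apply: setprod_min => // [u v Cu Cv|a b _ /sC Cb].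
  by rewrite -[u]mul1r; exact: CD.
by rewrite -[_ * _]addr0; exact: CD.
Qed.

Lemma prufer_genideal s x : x \in s -> x != 0 ->
  exists I : InvD D, I = @tofrac D @` genideal s :> set K.
Proof.
move=> xs x0; have : invertible (@tofrac D @` genideal s).
  apply: prD; first by exists s.
  move=> s0; have := genideal_mem xs; rewrite s0 => /= x00.
  by rewrite x00 eqxx in x0.
by move=> iI; exists (MkInvD iI).
Qed.

(** Take x * y = t outside of P as in [InvD_local], for the ideal generated by a and
b. Writing x as a combination of a and b, one of u = a * y and v = b * y is
outside of P, and a / b = u / v. *)
Lemma prufer_valuation P a b : a != 0 -> b != 0 ->
  locD P (a%:F / b%:F) \/ locD P (b%:F / a%:F).
Proof.
move=> a0 b0.
have [I IE] := prufer_genideal (mem_head a [:: b]) a0.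
have Ia : I a%:F by rewrite IE; exists a => //; apply: genideal_mem; rewrite inE eqxx.
have Ib : I b%:F by rewrite IE; exists b => //; apply: genideal_mem; rewrite !inE eqxx orbT.
have [x [y [t [Ix Jy Pt xy]]]] := InvD_local I P.
have [u uE] := InvD_mulV_integral Ia Jy; have [v vE] := InvD_mulV_integral Ib Jy.
have y0 : y != 0.
  by apply: contraNneq (spec_tofrac_neq0 Pt) => y0; rewrite -xy y0 mulr0.
have [Pu|Pu] := pselect (P u); last first.
  right; suff -> : b%:F / a%:F = v%:F / u%:F by exact: locD_frac.
  by rewrite -uE -vE -mulf_div divff ?mulr1.
have [Pv|Pv] := pselect (P v); last first.
  left; suff -> : a%:F / b%:F = u%:F / v%:F by exact: locD_frac.
  by rewrite -uE -vE -mulf_div divff ?mulr1.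
exfalso; apply: Pt; suff : exists2 d, P d & x * y = d%:F.
  by case=> d Pd; rewrite xy => /tofrac_inj ->.
have [z zJ <-] : (@tofrac D @` genideal [:: a; b]) x by rewrite -IE.
pose C := [set x : D | exists2 d, P d & x%:F * y = d%:F].
apply: (@genideal_min _ C) zJ => [|w].
  split; first by exists 0; rewrite ?tofrac0 ?mul0r //; exact: spec0.
  move=> r e f [d Pd dE] [d' Pd' dE']; exists (r * d + d'); first exact: specDM.
  by rewrite !tofracD !tofracM mulrDl -mulrA dE dE'.
by rewrite !inE => /orP[]/eqP ->; [exists u|exists v].
Qed.

Lemma maxSpec_comax P s : maxSpec P -> ~ P s ->
  exists r t, P t /\ 1 = r * s + t.
Proof.
move=> maxP Ps; apply: contrapT => h.
pose J := [set x | exists r t, P t /\ x = r * s + t].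
have JP : J = P.
  apply: maxP => [|[r [t [Pt e]]]|x Px].
  - by apply: ideal_adjoin; have [] := specP P.
  - by apply: h; exists r, t.
  - by exists 0, x; rewrite mul0r add0r.
apply: (Ps); suff : J s by rewrite JP.
by exists 1, 0; split; [exact: spec0|rewrite mul1r addr0].
Qed.

(** A generator of P D_P that belongs to P. *)
Definition uniformizer P p := [/\ P p, p != 0 & forall q, P q -> locD P (q%:F / p%:F)].

(** Any p in P outside of P^2 works: if p = q * (m / s) with q and m in P, then
s * p is in P^2, and so is p because s is invertible modulo the maximal ideal P. *)
Lemma uniformizer_ex P : maxSpec P -> P <> setprod P P :> set D ->
  exists p, uniformizer P p.
Proof.
move=> maxP PP.
have PPsub : setprod P P `<=` P.
  apply: setprod_min => [|u v|a b Pa _]; [exact: spec0|exact: specD|].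
  exact: specMr.
have [p Pp PPp] : exists2 p, P p & ~ setprod P P p.
  apply: contrapT => h; apply: PP; apply/seteqP; split=> // p Pp.
  by apply: contrapT => ?; apply: h; exists p.
have p0 : p != 0 by apply: contra_notN PPp => /eqP ->; exact: setprod0.
exists p; split => // q Pq.
have [->|q0] := eqVneq q 0; first by rewrite tofrac0 mul0r; exact: locD0.
have [//|[m [s [Ps pq]]]] := prufer_valuation P q0 p0.
have s0 := spec_tofrac_neq0 Ps.
have q0' : q%:F != 0 by rewrite tofrac_eq0.
have sp : s * p = q * m.
  apply: tofrac_inj; rewrite !tofracM.
  by move/eqP: pq; rewrite eqr_div // => /eqP; rewrite mulrC [RHS]mulrC.
have [Pm|Pm] := pselect (P m); last first.
  suff -> : q%:F / p%:F = s%:F / m%:F by exact: locD_frac.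
  by rewrite -[_ / p%:F]invf_div pq invf_div.
exfalso; apply: PPp.
have [r [t [Pt rt]]] := maxSpec_comax maxP Ps.
rewrite -[p]mul1r rt mulrDl; apply: setprodD; last exact: setprod_mul.
by rewrite -mulrA sp mulrCA; apply: setprod_mul => //; exact: specMl.
Qed.

Section Valuation.
Variables (P : spec D) (p : D).
Hypothesis pu : uniformizer P p.
Let Pp : P p. Proof. by case: pu. Qed.
Let p0 : p != 0. Proof. by case: pu. Qed.
Let pF0 : p%:F != 0. Proof. by rewrite tofrac_eq0. Qed.
Let pdiv q : P q -> locD P (q%:F / p%:F). Proof. by case: pu => _ _; apply. Qed.

Lemma unifVN : ~ locD P p%:F^-1.
Proof. by move=> /locD_unit/(_ p0). Qed.

Lemma unif_exp_ge0 (n : int) : locD P (p%:F ^ n) -> 0 <= n.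
Proof.
case: n => // n h; exfalso; apply: unifVN.
suff -> : p%:F^-1 = p%:F ^+ n * p%:F ^ Negz n.
  by apply: locDM => //; apply: locDX; exact: locD_tofrac.
by rewrite -[_ ^ Negz n]/(_ ^- n.+1) exprSr invfM mulVKf // expf_neq0.
Qed.

Lemma locD_nonunit x : locD P x -> x != 0 ->
  locD P x^-1 \/ locD P (x / p%:F).
Proof.
move=> [a [s [Ps ->]]] x0; have [Pa|Pa] := pselect (P a).
  right; rewrite mulrAC; apply: locDM; [exact: pdiv|exact: locDV].
by left; rewrite invf_div; exact: locD_frac.
Qed.

Lemma unif_expS x n : x / p%:F ^+ n.+1 = (x / p%:F ^+ n) / p%:F.
Proof. by rewrite exprSr invfM -mulrA; congr (_ * _); rewrite mulrC. Qed.

Lemma locD_unif_exp x : locD P x -> x != 0 ->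
  (forall n, locD P (x / p%:F ^+ n)) \/
  exists n, locD P (x / p%:F ^+ n) /\ locD P (p%:F ^+ n / x).
Proof.
move=> Lx x0; have [h|/existsNP[n nn]] := pselect (forall n, locD P (x / p%:F ^+ n)).
  by left.
right; elim: n nn => [|n IHn] nn; first by rewrite expr0 divr1 in nn.
have [h|//] := pselect (locD P (x / p%:F ^+ n)); exists n; split => //.
have xn0 : x / p%:F ^+ n != 0 by rewrite mulf_neq0 ?invr_neq0 ?expf_neq0.
have [|hp] := locD_nonunit h xn0; first by rewrite invf_div.
by exfalso; apply: nn; rewrite unif_expS.
Qed.

(** The contraction to D of the intersection of the powers of P D_P. *)
Definition infinite_prime : set D := [set a | forall n, locD P (a%:F / p%:F ^+ n)].

(** If neither a nor b is divisible by all powers of p, then p^n / a and p^m / b are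
in D_P, and divisibility of a * b by p^(n + m + 1) would put 1 / p in D_P. *)
Lemma infinite_prime_prime : prime_ideal infinite_prime.
Proof.
split; first split.
- by move=> n; rewrite tofrac0 mul0r; exact: locD0.
- move=> a u v hu hv n; rewrite tofracD tofracM mulrDl -mulrA.
  by apply: locDD => //; apply: locDM => //; exact: locD_tofrac.
- by move=> /(_ 1%N); rewrite tofrac1 mul1r expr1; exact: unifVN.
move=> a b hab; have [->|a0] := eqVneq a 0.
  by left=> n; rewrite tofrac0 mul0r; exact: locD0.
have [->|b0] := eqVneq b 0.
  by right=> n; rewrite tofrac0 mul0r; exact: locD0.
have aF0 : a%:F != 0 by rewrite tofrac_eq0.
have bF0 : b%:F != 0 by rewrite tofrac_eq0.
have [|[n [_ an]]] := locD_unif_exp (locD_tofrac P a) aF0; first by left.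
have [|[m [_ bm]]] := locD_unif_exp (locD_tofrac P b) bF0; first by right.
exfalso; apply: unifVN.
have := locDM (locDM an bm) (hab (n + m).+1).
suff -> : p%:F ^+ n / a%:F * (p%:F ^+ m / b%:F) * ((a * b)%:F / p%:F ^+ (n + m).+1)
  = p%:F^-1 by [].
rewrite tofracM unif_expS exprD.
exact: (divf_telescope _ aF0 bF0 (expf_neq0 n pF0) (expf_neq0 m pF0)).
Qed.

Definition infinite_spec : spec D := Spec infinite_prime_prime.

Lemma infinite_prime_sub : infinite_prime `<=` P.
Proof.
move=> d /(_ 1%N); rewrite expr1 => -[a [s [Ps dp]]].
have s0 := spec_tofrac_neq0 Ps.
have sd : s * d = p * a.
  apply: tofrac_inj; rewrite !tofracM.
  by move/eqP: dp; rewrite eqr_div // => /eqP; rewrite mulrC [RHS]mulrC.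
by have : P (s * d) by [rewrite sd; exact: specMr]; case/spec_prime.
Qed.

Lemma infinite_prime_unif : ~ infinite_prime p.
Proof.
move=> /(_ 2%N); rewrite expr2 invfM mulVKf //; exact: unifVN.
Qed.

(** An element divisible by all powers of p is in the maximal ideal of the
localization at [infinite_spec], and cannot be inverted there. *)
Lemma unit_at_infinite_prime z : locD P z -> z != 0 -> locD infinite_spec z^-1 ->
  exists n, locD P (z / p%:F ^+ n) /\ locD P (p%:F ^+ n / z).
Proof.
move=> Lz z0 [b [t [Qt zE]]].
have [zn|//] := locD_unif_exp Lz z0.
exfalso; apply: (Qt) => n /=.
have tF0 : t%:F != 0.
  by rewrite tofrac_eq0; apply: contra_notN Qt => /eqP ->; exact: spec0.
have -> : t%:F = b%:F * z.
  by move/eqP: zE; rewrite -[z^-1]mul1r eqr_div // mul1r => /eqP <-.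
rewrite -mulrA; apply: locDM => //; exact: locD_tofrac.
Qed.

End Valuation.
End Pruefer.

(** * The order of an invertible ideal at a prime with a uniformizer *)

(** Says that I D_P = p^n D_P. *)
Definition ord P (p : D) I (n : int) :=
  (forall y, I y -> locD P (y / p%:F ^ n)) /\
  exists x, [/\ I x, x != 0 & locD P (p%:F ^ n / x)].

Section LocalOrder.
Variables (P : spec D) (p : D).
Hypothesis pu : uniformizer P p.
Let p0 : p%:F != 0. Proof. by case: pu => _; rewrite tofrac_eq0. Qed.

Lemma ordM I J m n : ord P p I m -> ord P p J n -> ord P p (I * J)%g (m + n).
Proof.
move=> [hI [x [Ix x0 xm]]] [hJ [y [Jy y0 yn]]]; split.
  apply: setprod_min => [|u v Lu Lv|a b /hI La /hJ Lb] /=.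
  - by rewrite mul0r; exact: locD0.
  - by rewrite mulrDl; exact: locDD.
  - by rewrite expfzDr // -mulf_div; exact: locDM.
exists (x * y); split; [exact: setprod_mul|exact: mulf_neq0|].
by rewrite expfzDr // -mulf_div; exact: locDM.
Qed.

Lemma ord_le I m n : ord P p I m -> ord P p I n -> m <= n.
Proof.
move=> [hI _] [_ [x [Ix x0 xn]]]; rewrite -subr_ge0; apply: (unif_exp_ge0 pu).
suff -> : p%:F ^ (n - m) = p%:F ^ n / x * (x / p%:F ^ m).
  by apply: locDM => //; exact: hI.
by rewrite expfzDr // -invr_expz mulrA divfK.
Qed.

Lemma ord_uniq I m n : ord P p I m -> ord P p I n -> m = n.
Proof. by move=> hm hn; apply/eqP; rewrite eq_le !(ord_le (I := I)). Qed.

Lemma ord_unit I : I `<=` locD P -> (I^-1)%g `<=` locD P -> ord P p I 0.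
Proof.
move=> IP JP; split=> [y /IP|]; first by rewrite expr0z divr1.
have [x [s [Ix x0 Ps Jx _]]] := InvD_local_gen I P.
exists x; split=> //; rewrite expr0z.
rewrite -(mulKf (spec_tofrac_neq0 Ps) (1 / x)) mul1r.
by apply: locDM; [exact: locDV|exact: JP].
Qed.

Lemma ord0_sub I : ord P p I 0 -> I `<=` locD P.
Proof. by move=> [h _] x /h; rewrite expr0z divr1. Qed.

(** If x generates I D_P then so does p^n, up to a unit; hence s * p is in I for some s
outside of P, because I is radical. *)
Lemma ord_radical I n : I `<=` @fracD D -> radical_ideal (@tofrac D @^-1` I) ->
  @tofrac D @^-1` I `<=` P -> ord P p I n -> ord P p I 1.
Proof.
move=> ID [_ rI] IP [_ [x [Ix x0 xn]]].
have [Pp pn0 pdiv] := pu.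
have integ y : I y -> locD P (y / p%:F).
  by move=> /[dup]/ID[d _ <-] Id; apply: pdiv; exact: IP.
split=> [y /integ|]; first by rewrite expr1z.
have n1 : 0 <= n - 1.
  apply: (unif_exp_ge0 pu).
  suff -> : p%:F ^ (n - 1) = p%:F ^ n / x * (x / p%:F).
    by apply: locDM => //; exact: integ.
  by rewrite expfzDr // mulrA divfK.
case: n => [[|k]|//] in xn n1 *; first by [].
move: xn => [a [s [Ps xE]]].
(* Here p^(k+1) / x = a / s, so s * p^(k+1) is in I, and radicality gives s * p. *)
have Isp : I (s * p)%:F.
  apply: (rI _ k.+1) => /=; rewrite exprMn exprS mulrAC mulrC.
  rewrite tofracM; apply: InvDM.
  rewrite tofracM tofracXn.
  suff -> : s%:F * p%:F ^+ k.+1 = a%:F * x by exact: InvDM.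
  have /eqP := xE; rewrite eqr_div ?(spec_tofrac_neq0 Ps) // => /eqP <-.
  by rewrite mulrC.
exists (s * p)%:F; split; first exact: Isp.
  by rewrite tofrac_eq0; exact: mulf_neq0 (spec_neq0 Ps) pn0.
by rewrite expr1z tofracM invfM mulrCA mulfV // mulr1; exact: locDV.
Qed.

(** The prime Q = [infinite_spec] is strictly below P, so I and its inverse are
contained in D_Q. A local generator x of I at P is therefore a unit of D_Q, and
so neither x nor its inverse, whichever is in D_P, is divisible by all powers of
p. *)
Lemma ord_ex I : prufer D ->
  (forall Q, Q `<=` P -> ~ P `<=` Q -> ~ supp I Q) ->
  exists n, ord P p I n.
Proof.
move=> prD hI.
have [Pp pn0 pdiv] := pu.
pose Q := infinite_spec pu.
have QP : Q `<=` P by exact: infinite_prime_sub pu.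
have /contrapT IQ : ~ supp I Q.
  by apply: hI => // /(_ p Pp); exact: infinite_prime_unif pu.
have [x [s [Ix x0 Ps Jx genx]]] := InvD_local_gen I P.
have [[_ _ [d d0 /(_ x Ix)[a _ aE]]] _] := InvDP I.
have dF0 : d%:F != 0 by rewrite tofrac_eq0.
have xE : x = a%:F / d%:F by rewrite aE mulrC mulKf.
have a0 : a != 0 by apply: contraNneq x0 => a0; rewrite xE a0 tofrac0 mul0r.
have [Lx|Lx] := prufer_valuation prD P a0 d0.
  rewrite -xE in Lx.
  have [|n [n1 n2]] := unit_at_infinite_prime (pu := pu) Lx x0.
    rewrite -(mulKf (spec_tofrac_neq0 Ps) x^-1).
    apply: locDM; last exact: (InvV_sub IQ).
    by apply: locDV => /QP.
  exists n%:Z; split=> [y Iy|]; last by exists x.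
  rewrite -[y](divfK x0) -[X in locD _ X]mulrA.
  by apply: locDM; [exact: genx|exact: n1].
rewrite -invf_div -xE in Lx.
have [||n [n1 n2]] := unit_at_infinite_prime (pu := pu) Lx; first by rewrite invr_eq0.
  by rewrite invrK; exact: (Inv_sub IQ).
have pN : p%:F ^ (- n%:Z) = p%:F ^- n by rewrite -invr_expz.
exists (- n%:Z); split=> [y Iy|].
  rewrite pN invrK -[y](divfK x0) -[X in locD _ X]mulrA; apply: locDM; first exact: genx.
  by rewrite mulrC -[x in _ * x]invrK.
by exists x; split=> //; rewrite pN mulrC.
Qed.

End LocalOrder.

Lemma maximal_exists (J : set D) : ideal J -> ~ J 1 ->
  exists2 M : spec D, maxSpec M & J `<=` M.
Proof.
move=> [J0 JD] J1.
(* The union with J accounts for the empty chain. *)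
pose proper (A : set D) := ideal (A `|` J) /\ ~ (A `|` J) 1.
have [F Fproper Ftot|A [[AJ A1] Amax]] := @Zorn_bigcup D proper.
  split; first split.
  - by right.
  - move=> a u v [[A FA Au]|Ju] [[B FB Bv]|Jv].
    + have [AB|BA] := Ftot _ _ FA FB.
        have [[_ h] _] := Fproper _ FB.
        have [?|?] := h a u v (or_introl (AB _ Au)) (or_introl Bv).
          by left; exists B.
        by right.
      have [[_ h] _] := Fproper _ FA.
      have [?|?] := h a u v (or_introl Au) (or_introl (BA _ Bv)).
        by left; exists A.
      by right.
    + have [[_ h] _] := Fproper _ FA.
      have [?|?] := h a u v (or_introl Au) (or_intror Jv).
        by left; exists A.
      by right.
    + have [[_ h] _] := Fproper _ FB.
      have [?|?] := h a u v (or_intror Ju) (or_introl Bv).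
        by left; exists B.
      by right.
    + by right; exact: JD.
  - by move=> [[A FA A1]|//]; have [_] := Fproper _ FA; apply; left.
set M : set D := A `|` J in AJ A1.
have Mmax (N : set D) : ideal N -> ~ N 1 -> M `<=` N -> N = M.
  move=> NI N1 MN; apply/seteqP; split=> //.
  have JN : J `<=` N by move=> x Jx; apply: MN; right.
  have [NA|NA] := pselect (N `<=` A); first by move=> x /NA; left.
  exfalso; apply: (Amax N); first by split=> // x Ax; apply: MN; left.
  have NJ : N `|` J = N by apply/setUidPl.
  by rewrite /proper NJ.
have primeM : prime_ideal M.
  split=> // a b Mab; have [Ma|Ma] := pselect (M a); [by left|right].
  pose N := [set x | exists r t, M t /\ x = r * a + t].
  have [M0 MD] := AJ.
  have [[r [t [Mt e]]]|N1] := pselect (N 1).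
    rewrite -[b]mul1r e mulrDl -mulrA [t * b]mulrC -[b * t]addr0.
    by do 2 apply: (MD) => //.
  exfalso; apply: Ma; rewrite -(Mmax N) //.
  - by exists 1, 0; rewrite mul1r addr0.
  - exact: ideal_adjoin.
  - by move=> x Mx; exists 0, x; rewrite mul0r add0r.
by exists (Spec primeM) => //= x Jx; right.
Qed.

(** Otherwise the ideal of the denominators of x would be in some maximal ideal M. *)
Lemma bigcap_locD x :
  (forall M : spec D, maxSpec M -> locD M x) -> @fracD D x.
Proof.
move=> hx; have [F0 FD _] := fractional_fracD D.
pose J := [set d : D | @fracD D (d%:F * x)].
have [J1|J1] := pselect (J 1); first by move: J1; rewrite /J /= tofrac1 mul1r.
have [|M maxM JM] := maximal_exists _ J1.
  split; first by rewrite /J /= tofrac0 mul0r.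
  by move=> a u v hu hv; rewrite /J /= tofracD tofracM mulrDl -mulrA; exact: FD.
have [a [s [Ms xE]]] := hx M maxM.
exfalso; apply: (Ms); apply: JM; exists a => //.
by rewrite xE mulrC divfK // (spec_tofrac_neq0 Ms).
Qed.

End Localization.

(** * Compact covers and integer-valued continuous functions *)

(** Compactness is applied to the filter of the finite families of indices, ordered
by inclusion: near each point of K, all large enough families cover. *)
Lemma compact_finite_cover (T : topologicalType) (A : eqType) (K : set T)
    (G : set A) (W : A -> set T) :
  compact K -> (forall x, K x -> exists2 a, G a & nbhs x (W a)) ->
  exists2 l : seq A, (forall a, a \in l -> G a) &
    forall x, K x -> exists2 a, a \in l & W a x.
Proof.
move=> /compact_near_coveringP cK KW.
pose F : set_system (seq A) :=
  [set B | exists l0 : seq A, forall l : seq A, {subset l0 <= l} -> B l].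
have FF : Filter F.
  split=> [|B C [l lB] [m mC]|B C BC [l lB]]; first by exists [::].
    exists (l ++ m) => n lmn; split; [apply: lB|apply: mC] => a al; apply: lmn;
      by rewrite mem_cat al ?orbT.
  by exists l => m lm; apply: BC; exact: lB.
have [|l0 hl] := cK _ F (fun l x => exists a, [/\ a \in l, G a & W a x]) FF.
  move=> x /KW[a Ga Wa].
  exists (W a, [set l | a \in l]); first split => //.
    by exists [:: a] => l; apply; rewrite inE.
  by move=> [y l] [Wy al]; exists a.
exists [seq a <- l0 | `[< G a >]] => [a|x Kx].
  by rewrite mem_filter => /andP[/asboolP].
have [a [al Ga Wx]] := hl l0 (fun _ => id) x Kx.
by exists a => //; rewrite mem_filter al andbT; exact/asboolP.
Qed.

Lemma continuous_locally_const (T : topologicalType) (f : T -> int) :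
  continuous (f : T -> discrete_topology int) <->
  forall x, nbhs x [set z | f z = f x].
Proof.
split=> cf x; first exact: (cf x [set f x] (discrete_set1 _)).
move=> A /= fyA; apply: filterS (cf x) => z /= fz.
by rewrite /= fz; exact: (@nbhs_singleton (discrete_topology int) (f x)).
Qed.

(** * Orders along the splitting set *)

Section GlobalValuation.
Variables (D : idomainType) (X : set (spec D)).
Local Notation K := {fraction D}.
Local Notation "x %:F" := (@tofrac D x).
Implicit Types (P Q : spec D) (I J : InvD D) (s t : seq D).
Hypotheses (prD : prufer D) (Xmax : X `<=` @maxSpec D)
  (Xdisc : discrete_splitting_set X).

Definition unif P : D := xget 0 [set p | uniformizer P p].

Lemma unifP P : X P -> uniformizer P (unif P).
Proof.
move=> XP; have [p pu] := uniformizer_ex prD (Xmax XP) (Xdisc.2 P XP).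
by rewrite /unif; case: xgetP => [q -> //|/(_ p)].
Qed.

(** The exponent of P in I; the value is meaningful for P in X and I in Inv_X(D),
by [pvalP]. *)
Definition pval P I : int := xget 0 [set n | ord P (unif P) I n].

Lemma pvalP P I : X P -> I \in InvX X -> ord P (unif P) I (pval P I).
Proof.
move=> XP /in_InvX IX.
have [|n hn] := ord_ex (unifP XP) (I := I) prD.
  move=> Q QP PQ /IX/Xmax maxQ; apply: PQ; rewrite -[X in _ `<=` X](maxQ P) //.
    by have [] := specP P.
  exact: spec1.
by rewrite /pval; case: xgetP => [m -> //|/(_ n)].
Qed.

Lemma pval_eq P I n : X P -> ord P (unif P) I n -> pval P I = n.
Proof.
move=> XP hn; rewrite /pval; case: xgetP => [m _ hm|/(_ n) //].
exact: (ord_uniq (unifP XP) hm hn).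
Qed.

Lemma InvX1 : (1%g : InvD D) \in InvX X.
Proof. by have [] := InvX_closed X. Qed.

Lemma InvXMV I J : I \in InvX X -> J \in InvX X -> (I * J^-1)%g \in InvX X.
Proof. by have [_ h] := InvX_closed X => ? ?; exact: h. Qed.

Lemma InvXV I : I \in InvX X -> (I^-1)%g \in InvX X.
Proof. by move=> IX; rewrite -[(I^-1)%g]mul1g; apply: InvXMV => //; exact: InvX1. Qed.

Lemma pvalM P I J : X P -> I \in InvX X -> J \in InvX X ->
  pval P (I * J)%g = pval P I + pval P J.
Proof.
by move=> XP IX JX; apply: pval_eq => //; apply: (ordM (unifP XP)); exact: pvalP.
Qed.

Lemma pval1 P : X P -> pval P 1%g = 0.
Proof.
move=> XP; have := pvalM XP InvX1 InvX1; rewrite mulg1 -[LHS]addr0.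
by move/addrI.
Qed.

Lemma pvalV P I : X P -> I \in InvX X -> pval P (I^-1)%g = - pval P I.
Proof.
move=> XP IX; apply/eqP; rewrite -addr_eq0 -pvalM ?InvXV //.
by rewrite mulVg pval1.
Qed.

Lemma pval_eq0 P I : X P -> I \in InvX X ->
  pval P I = 0 <-> ~ supp_ideal I `<=` P.
Proof.
move=> XP IX; split=> [v0 AP|/existsNP[t /not_implyP[It Pt]]].
  have oI := pvalP XP IX; have oJ := pvalP XP (InvXV IX).
  rewrite pvalV // v0 oppr0 in oJ; rewrite v0 in oI.
  by have [t Pt /AP] := supp_ideal_inv (ord0_sub oI) (ord0_sub oJ).
have [IP JP] := supp_ideal_locD It Pt.
by apply: pval_eq => //; exact: ord_unit.
Qed.

Lemma pval0_integral I : I \in InvX X -> (forall P, X P -> pval P I = 0) ->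
  I `<=` @fracD D.
Proof.
move=> IX v0 x Ix; apply: bigcap_locD => M _.
have [XM|XM] := pselect (X M).
  by have := pvalP XM IX; rewrite v0 // => /ord0_sub; apply.
apply: Inv_sub Ix => //; apply: contrapT => sM; apply: XM.
by move/in_InvX : IX; apply.
Qed.

(** With I and its inverse both integral, the relation of [InvD_unity] puts 1 in I. *)
Lemma pval0_eq1 I : I \in InvX X -> (forall P, X P -> pval P I = 0) -> I = 1%g.
Proof.
move=> IX v0; apply: InvD_inj => /=; apply/seteqP.
split; first exact: pval0_integral.
have JD : (I^-1)%g `<=` @fracD D.
  by apply: pval0_integral => [|P XP]; rewrite ?InvXV // pvalV // v0 ?oppr0.
have [s [sI s1]] := InvD_unity I.
suff I1 : I 1 by move=> _ [a _ <-]; rewrite -[_%:F]mulr1; exact: InvDM.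
rewrite s1 big_seq; apply: big_ind => [|u v Iu Iv|q /sI[q1 /JD[d _ <-]]].
- exact: InvD0.
- by rewrite -[u]mul1r -tofrac1; exact: InvD_lin.
- by rewrite mulrC; exact: InvDM.
Qed.

Lemma pval_inj I J : I \in InvX X -> J \in InvX X ->
  (forall P, X P -> pval P I = pval P J) -> I = J.
Proof.
move=> IX JX e; suff : (I * J^-1)%g = 1%g by move/mulg1_eq/invg_inj.
apply: pval0_eq1 => [|P XP]; first exact: InvXMV.
by rewrite pvalM ?InvXV // pvalV // e // subrr.
Qed.

Hypothesis Xcrit : Crit X = set0.

(** Boolean, so that it can be used as an indicator function. *)
Definition contains P (s : seq D) : bool := all (fun d => `[< P d >]) s.

Lemma containsP P s : reflect (forall d, d \in s -> P d) (contains P s).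
Proof. by apply: (iffP allP) => h d /h/asboolP. Qed.

Lemma contains_genideal P s : contains P s <-> genideal s `<=` P.
Proof.
split=> [/containsP sP|sP]; first by apply: genideal_min => //; have [] := specP P.
by apply/containsP => d ds; apply: sP; exact: genideal_mem.
Qed.

(** The radical ideal I bounds the orders of (s) by 1 on X, and keeps the support of
(s) inside X. *)
Definition tame (s : seq D) := exists I, [/\ I \in InvX X, I `<=` @fracD D,
  radical_ideal (@tofrac D @^-1` I) & @tofrac D @^-1` I `<=` genideal s].

(** Since no point of X is critical, P contains a radical ideal of Inv_X(D), and this
ideal is finitely generated by [InvD_unity]. *)
Lemma tame_ex P : X P -> exists2 s, tame s & contains P s.
Proof.
move=> XP.
have : exists I : InvD D, [/\ I \in InvX X, I `<=` @fracD D,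
         radical_ideal (@tofrac D @^-1` I) & @tofrac D @^-1` I `<=` P].
  apply: contrapT => h; have : Crit X P by split=> //; exact: Xmax.
  by rewrite Xcrit.
move=> [I [IX ID rI IP]].
have [s [sI s1]] := InvD_unity I.
have h (q : K * K) : exists d : D, q \in s -> q.1 = d%:F.
  have [qs|qs] := boolP (q \in s); last by exists 0.
  by have [/ID[d _ <-] _] := sI _ qs; exists d.
have [F FE] := choice h.
have FI q : q \in s -> I (F q)%:F by move=> qs; rewrite -FE //; case: (sI _ qs).
exists [seq F q | q <- s]; last first.
  by apply/containsP => _ /mapP[q qs ->]; apply: IP; exact: FI.
exists I; split=> // x /= Ix.
suff : (@tofrac D @` genideal [seq F q | q <- s]) x%:F by case=> y ? /tofrac_inj <-.
rewrite -[x%:F]mulr1 s1 mulr_sumr big_seq.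
apply: big_ind => [|_ _ [u gu <-] [v gv <-]|q qs].
- by exists 0; [exact: setprod0|rewrite tofrac0].
- by exists (u + v); [exact: setprodD|rewrite tofracD].
- have [_ q2] := sI _ qs; have [d dE] := InvD_mulV_integral Ix q2.
  exists (d * F q); last by rewrite tofracM -dE FE // -mulrA [q.2 * _]mulrC.
  by apply: setprod_mul => //=; exact: map_f.
Qed.

Lemma genideal_sub (s t : seq D) : {subset s <= t} -> genideal s `<=` genideal t.
Proof. by move=> st x [u [uP ->]]; exists u; split=> // q /uP[? /st]. Qed.

Lemma tame_cat s t : tame s -> tame (s ++ t).
Proof.
move=> [I [? ? ? h]]; exists I; split=> //; apply: subset_trans h _.
by apply: genideal_sub => x; rewrite mem_cat => ->.
Qed.

(** At a prime P containing s, the order is at least 1 because (s) is in P, and at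
most 1 because (s) contains a radical ideal, which has order 1. *)
Lemma tame_indicator s : tame s -> exists2 I, I \in InvX X &
  forall P, X P -> pval P I = (contains P s)%:R.
Proof.
move=> [R [RX RD rR Rs]].
have [I IE] : exists I : InvD D, I = @tofrac D @` genideal s :> set K.
  apply: contrapT => nI.
  (* If all entries of s vanish then R = 0, which is not invertible. *)
  have s0 x : x \in s -> x = 0.
    move=> xs; apply: contrapT => /eqP x0; apply: nI.
    exact: prufer_genideal xs x0.
  have [u [su s1]] := InvD_unity R.
  have : 1 = 0 :> K.
    rewrite {1}s1 big_seq big1 // => q /su[q1 _].
    have [d _ dE] := RD _ q1; rewrite -dE in q1 *.
    have := Rs _ q1 => -[w [wP ->]].
    rewrite big_seq big1 ?tofrac0 ?mul0r // => z /wP[_ /= /s0 ->].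
    by rewrite mulr0.
  by apply/eqP; exact: oner_neq0.
have ID : I `<=` @fracD D by rewrite IE => _ [x _ <-]; exists x.
have Ipre : @tofrac D @^-1` I = genideal s.
  rewrite IE; apply/seteqP; split=> [x [y ? /tofrac_inj <-] //|x sx].
  by exists x.
have RI : @tofrac D @^-1` R `<=` @tofrac D @^-1` I by rewrite Ipre.
have IX : I \in InvX X.
  apply/in_InvX => P /(supp_integral _ ID) IP; move/in_InvX : RX; apply.
  by apply/(supp_integral _ RD); exact: subset_trans RI IP.
exists I => // P XP.
have [sP|sP] := boolP (contains P s).
  apply: pval_eq => //.
  move/contains_genideal : sP; rewrite -Ipre => IP.
  have [Pp _ pdiv] := unifP XP.
  have [_ [x [Rx x0 xp]]] :=
    ord_radical (unifP XP) RD rR (subset_trans RI IP) (pvalP XP RX).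
  split=> [y|]; first by move=> /[dup]/ID[d _ <-] /IP/pdiv; rewrite expr1z.
  exists x; split=> //; have [d _ dE] := RD _ Rx; rewrite -dE in Rx *.
  exact: RI.
apply/pval_eq0 => //.
move/negP : sP => sP AP; apply: sP; apply/contains_genideal; rewrite -Ipre.
apply/supp_integral => //; exact: supp_ideal_supp.
Qed.

(** * The topology of X and the image of the order map *)

(** Finitely many generators suffice for a finite intersection of loci of finitely
generated ideals. *)
Lemma open_spec (B : set (spec D)) P : open B -> B P ->
  exists2 s, contains P s & forall Q, contains Q s -> B Q.
Proof.
move=> [C Cfin <-] [b bC bP]; have [F Fsub bE] := Cfin _ bC.
pose l : seq (set D) := enum_fset F.
have lfg L : L \in l -> fg_ideal L by move=> Ll; apply: set_mem; exact: (Fsub L Ll).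
have bl Q : isBaseTopological.b b Q <-> forall L, L \in l -> L `<=` Q.
  rewrite -[isBaseTopological.b b]/b -bE; split=> h L Ll; exact: h.
have [G GE] : exists G : set D -> seq D, forall L, L \in l -> L = genideal (G L).
  have h (L : set D) : exists s : seq D, L \in l -> L = genideal s.
    have [/lfg[s]|Ll] := boolP (L \in l); first by exists s.
    by exists [::].
  by have [G GE] := choice h; exists G.
exists (flatten [seq G L | L <- l]).
  apply/containsP => d /flattenP[_ /mapP[L Ll ->] dG].
  have := iffLR (bl P) bP L Ll d; rewrite {1}(GE _ Ll); apply.
  exact: genideal_mem.
move=> Q /containsP Qs; exists b; first exact: bC.
apply/bl => L Ll; rewrite (GE _ Ll); apply/contains_genideal/containsP => d dG.
by apply: Qs; apply/flattenP; exists (G L) => //; exact: map_f.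
Qed.

Lemma nbhs_contains (y : X) (A : set X) : nbhs y A ->
  exists2 s, contains (val y) s & forall z : X, contains (val z) s -> A z.
Proof.
case=> _ [[B oB <-] By BA]; have [s ys sB] := open_spec oB By.
by exists s => // z /sB; exact: BA.
Qed.

Lemma open_contains s : open [set z : X | contains (val z) s].
Proof.
exists (zero_locus (genideal s)); last first.
  by apply/seteqP; split=> z /contains_genideal.
exists [set zero_locus (genideal s)]; last by rewrite bigcup_set1.
move=> _ ->; exists [fset genideal s]%fset.
  by move=> J /fset1P ->; apply/mem_set; exists s.
by apply/seteqP; split=> P h; [apply: h; exact: fset11|move=> J /fset1P ->].
Qed.

(** The image of the order map, as a set of functions. *)
Definition realized (g : X -> int) :=
  exists2 I, I \in InvX X & forall y : X, pval (val y) I = g y.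

Lemma realized0 : realized (fun=> 0).
Proof. by exists 1%g => [|y]; [exact: InvX1|rewrite pval1 //; exact: set_valP]. Qed.

Lemma realizedB g h : realized g -> realized h ->
  realized (fun y => g y - h y).
Proof.
move=> [I IX Ig] [J JX Jh]; exists (I * J^-1)%g => [|y]; first exact: InvXMV.
have Xy := set_valP y.
by rewrite pvalM ?InvXV // pvalV // Ig Jh.
Qed.

Lemma realizedN g : realized g -> realized (fun y => - g y).
Proof.
move=> /(realizedB realized0)[I IX Ig]; exists I => // y.
by rewrite Ig sub0r.
Qed.

Lemma realizedD g h : realized g -> realized h ->
  realized (fun y => g y + h y).
Proof.
move=> Rg /realizedN Rh; have [I IX Ig] := realizedB Rg Rh.
by exists I => // y; rewrite Ig opprK.
Qed.

Lemma realizedMz g (c : int) : realized g -> realized (fun y => c * g y).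
Proof.
move=> Rg.
have nat_case n : realized (fun y => n%:Z * g y).
  elim: n => [|n [I IX Ig]].
    by have [I IX Ig] := realized0; exists I => // y; rewrite Ig mul0r.
  have [|J JX Jg] := realizedD (g := fun y => n%:Z * g y) _ Rg; first by exists I.
  by exists J => // y; rewrite Jg -addn1 PoszD mulrDl mul1r.
case: c => [n|n]; first exact: nat_case.
have [I IX Ig] := realizedN (nat_case n.+1).
by exists I => // y; rewrite Ig NegzE mulNr.
Qed.

Lemma realized_indicator s : tame s ->
  realized (fun y => (contains (val y) s)%:R).
Proof.
move=> /tame_indicator[I IX Is]; exists I => // y; apply: Is; exact: set_valP.
Qed.

Lemma nbhs_contains_mem (y : X) s : contains (val y) s ->
  nbhs y [set z : X | contains (val z) s].
Proof. by move=> ys; apply: open_nbhs_nbhs; split=> //; exact: open_contains. Qed.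

(** With n the order of I at y, the order function of J is that of I minus n times
the indicator of a neighbourhood of y, so J has order 0 at y. It keeps order 0 at
all z that avoid some t outside of y. The primes containing m, with
1 = r * t + m, form a neighbourhood of y whose elements avoid t. *)
Lemma pval_continuous I : I \in InvX X ->
  forall y : X, nbhs y [set z : X | pval (val z) I = pval (val y) I].
Proof.
move=> IX y; have Xy := set_valP y.
have [s st ys] := tame_ex Xy.
set n := pval _ I.
have [J JX Jv] : realized (fun z => pval (val z) I - n * (contains (val z) s)%:R).
  by apply: realizedB; [exists I|exact/realizedMz/realized_indicator].
have Jy : pval (val y) J = 0 by rewrite Jv ys mulr1 subrr.
have /existsNP[t /not_implyP[tJ yt]] := iffLR (pval_eq0 Xy JX) Jy.
have [r [m [ym e]]] := maxSpec_comax (Xmax Xy) yt.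
have yms : contains (val y) (m :: s) by rewrite /= ys andbT; exact/asboolP.
apply: filterS (nbhs_contains_mem yms) => z /= /andP[/asboolP zm zs].
have zt : ~ val z t.
  by move=> zt; apply: (@spec1 _ (val z)); rewrite e; exact: specDM.
have : pval (val z) J = 0.
  by apply/pval_eq0; [exact: set_valP|by []|move/(_ _ tJ)].
by rewrite Jv zs mulr1 => /eqP; rewrite subr_eq0 => /eqP.
Qed.

(** An ultrafilter F on the support converges to the prime Q of the d that belong to
F-almost all primes. This Q contains [supp_ideal I], so it is in the support of I,
hence in X. *)
Lemma pval_compact I : I \in InvX X ->
  compact [set y : X | pval (val y) I != 0].
Proof.
move=> IX; rewrite compact_ultra => F FU FI.
have FF : Filter F by exact: filter_filter.
pose Q0 : set D := [set d | F [set z : X | val z d]].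
have Q0prime : prime_ideal Q0.
  split; first split.
  - by apply: filterS filterT => z _; exact: spec0.
  - by move=> a u v; apply: filterS2 => z zu zv; exact: specDM.
  - move=> F1; have /filter_ex[z /= z1] := F1.
    by have := spec1 z1.
  move=> a b Fab; have [|Fa] := in_ultra_setVsetC [set z : X | val z a] FU.
    by left.
  by right; apply: filterS2 Fab Fa => z /= zab za; case/spec_prime: zab.
pose Q := Spec Q0prime.
have IQ : supp_ideal I `<=` Q.
  move=> d dI; apply: filterS FI => z /= /eqP vz; apply: contrapT => zd.
  by apply: vz; apply/pval_eq0 => //; [exact: set_valP|move/(_ _ dI)].
have XQ : X Q by move/in_InvX : IX; apply; exact: supp_ideal_supp.
exists (SigSub (mem_set XQ)); split.
  by apply/eqP => /(iffLR (pval_eq0 XQ IX)); apply.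
move=> A /nbhs_contains[s /containsP Qs sA]; apply: filterS sA _.
elim: s Qs => [|d s IHs] Qs; first by apply: filterS filterT.
have Fs := IHs (fun e es => Qs e (mem_behead (es : e \in behead (d :: s)))).
apply: filterS2 (Qs d (mem_head _ _)) Fs => z /= zd ->.
by rewrite andbT; exact/asboolP.
Qed.

Lemma pval_Cc I : I \in InvX X -> (fun y : X => pval (val y) I) \in @Cc (set_type X).
Proof.
move=> IX; apply/in_Cc; split.
  by apply/continuous_locally_const; exact: pval_continuous.
suff -> : fsupport (fun y : X => pval (val y) I) =
    [set y : X | pval (val y) I != 0] by exact: pval_compact.
apply/seteqP; split=> y.
  move=> /(_ _ (pval_continuous IX y))[z [z0 vz]].
  by apply/eqP => y0; apply: z0; exact: etrans vz y0.
by move=> /eqP y0; exact: subset_closure.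
Qed.

(** With U and V the sets of the primes that contain s, respectively some entry of
l, and W that of the primes containing t, the induction rests on
1_((U u V) n W) = 1_(U n W) + 1_(V n W) - 1_(V n (U n W)), where U n W is given by
[s ++ t]. This is why t varies. *)
Lemma realized_patch (f : X -> int) (l : seq (seq D)) :
  (forall s, s \in l -> tame s /\
     exists c, forall z : X, contains (val z) s -> f z = c) ->
  forall t, realized
    (fun y => f y * (has (contains (val y)) l && contains (val y) t)%:R).
Proof.
elim: l => [|s l IHl] hl t.
  by have [I IX Ig] := realized0; exists I => // y; rewrite Ig mulr0.
have [st [c fc]] := hl s (mem_head _ _).
have {}IHl := IHl (fun u ul => hl u (mem_behead (ul : u \in behead (s :: l)))).
have := realizedB (realizedD (realizedMz c (realized_indicator (tame_cat t st)))
                             (IHl t)) (IHl (s ++ t)).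
move=> [I IX Ig]; exists I => // y; rewrite Ig /= /contains !all_cat.
rewrite -/(contains _ s) -/(contains _ t).
have [/fc -> /=|_] := boolP (contains (val y) s).
  by rewrite addrK.
by rewrite /= mulr0 add0r andbF mulr0 subr0.
Qed.

Lemma Cc_realized (f : X -> int) : f \in @Cc (set_type X) -> realized f.
Proof.
move=> /in_Cc[/continuous_locally_const cf kf].
pose G s := tame s /\ exists c, forall z : X, contains (val z) s -> f z = c.
have [|l lG lf] := @compact_finite_cover _ (seq D) _ G
    (fun s => [set z : X | contains (val z) s]) kf.
  move=> y _; have [s st ys] := tame_ex (set_valP y).
  have [t yt tf] := nbhs_contains (cf y).
  exists (s ++ t).
    split; first exact: tame_cat.
    by exists (f y) => z; rewrite /contains all_cat => /andP[_]; exact: tf.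
  by apply: nbhs_contains_mem; rewrite /contains all_cat; exact/andP.
have [I IX Ig] := realized_patch lG [::].
exists I => // y; rewrite Ig andbT.
have [->|fy] := eqVneq (f y) 0; first by rewrite mul0r.
have [|s sl ys] := lf y; first by apply: subset_closure; exact/eqP.
suff -> : has (contains (val y)) l by rewrite mulr1.
by apply/hasP; exists s.
Qed.

End GlobalValuation.

Theorem corollary6p6 (D : idomainType) (X : set (spec D)) :
  prufer D ->
  X `<=` @maxSpec D ->
  discrete_splitting_set X ->
  Crit X = set0 ->
  exists phi : InvX_type X -> Cc_type (set_type X),
    bijective phi /\ {morph phi : I J / (I * J)%g >-> I + J}.
Proof.
move=> prD Xmax Xdisc Xcrit.
have hCc (I : InvX_type X) := pval_Cc prD Xmax Xdisc Xcrit (valP I).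
pose phi (I : InvX_type X) : Cc_type (set_type X) :=
  exist (fun f => f \in @Cc (set_type X)) (fun y : X => pval (val y) (val I)) (hCc I).
exists phi; split.
  have phi_inj : injective phi.
    move=> I J /(congr1 val) /= e; apply: val_inj.
    apply: (pval_inj prD Xmax Xdisc (valP I) (valP J)) => P XP.
    exact: (congr1 (fun g => g (SigSub (mem_set XP))) e).
  have phi_surj (f : Cc_type (set_type X)) : exists I, phi I = f.
    have [I IX If] := Cc_realized prD Xmax Xdisc Xcrit (valP f).
    exists (exist (fun J => J \in InvX X) I IX); apply: val_inj; apply/funext => y.
    exact: If.
  have [psi psiK] := choice phi_surj.
  by exists psi => // I; apply: phi_inj; rewrite psiK.
move=> I J; apply: val_inj; apply/funext => y.
exact: (pvalM prD Xmax Xdisc (set_valP y) (valP I) (valP J)).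
Qed.
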